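(* Let $f(z) = z + a_2 z^2 + a_3 z^3 + a_4 z^4 + \cdots$ be a bi-convex function, i.e. $f\in\mathcal{K}_{\Sigma}[0]=\mathcal{CV}_{\Sigma}$. Then $$|a_{2}a_{4}-a_{3}^2| \leq \frac{1}{8}.$$
   Context: Let $\mathbb{D}=\{z\in\mathbb{C}: |z|<1\}$. Let $\mathcal{S}$ be the class of univalent analytic functions $f$ on $\mathbb{D}$ with expansion $f(z)=z+a_2z^2+a_3z^3+\cdots$. The class $\Sigma$ of bi-univalent functions consists of all $f\in\mathcal{S}$ whose inverse $f^{-1}$ (defined near $0$) has a univalent analytic continuation to all of $\mathbb{D}$. The class $\mathcal{CV}$ of convex functions consists of $h\in\mathcal{S}$ with $\Re\left(1+zh''(z)/h'(z)\right)>0$ for $z\in\mathbb{D}$. The class $\mathcal{CV}_\Sigma$ of bi-convex functions consists of those $h\in\Sigma$ such that both $h$ and the analytic continuation of $h^{-1}$ to $\mathbb{D}$ belong to $\mathcal{CV}$. $\mathcal{K}_{\Sigma}[0]$ (strongly bi-close-to-convex functions of order $0$) is by convention the class $\mathcal{CV}_\Sigma$. *)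

(* Defs.v *)
From Stdlib Require Export Reals.
From Coquelicot Require Export Coquelicot.

Open Scope R_scope.

Definition unit_disk (z : C) : Prop := Cmod z < 1.

Definition analytic_on_disk (f : C -> C) : Prop :=
  forall z : C, unit_disk z -> ex_derive f z.

Definition univalent_on_disk (f : C -> C) : Prop :=
  forall z w : C, unit_disk z -> unit_disk w -> f z = f w -> z = w.

Definition normalized_expansion (f : C -> C) (a : nat -> C) : Prop :=
  a 0%nat = 0%C /\ a 1%nat = 1%C /\
  forall z : C, unit_disk z -> is_pseries a z (f z).

(* Functions are total on [C]; membership in each class below constrains
   only the values on the unit disk. *)
Definition class_S (f : C -> C) : Prop :=
  analytic_on_disk f /\ univalent_on_disk f /\
  exists a : nat -> C, normalized_expansion f a.

(* By injectivity of [f] on the disk, the last clause says that near 0 the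
   inverse of [f] is defined and equal to [g]. *)
Definition inverse_continuation (f g : C -> C) : Prop :=
  analytic_on_disk g /\ univalent_on_disk g /\
  exists r : R, 0 < r /\
    forall w : C, Cmod w < r -> unit_disk (g w) /\ f (g w) = w.

Definition class_Sigma (f : C -> C) : Prop :=
  class_S f /\ exists g : C -> C, inverse_continuation f g.

(* The quotient is a genuine one: [C_derive h] does not vanish on the disk
   when [h] is univalent there. *)
Definition class_CV (h : C -> C) : Prop :=
  class_S h /\
  forall z : C, unit_disk z ->
    0 < Re (1 + z * C_derive (C_derive h) z / C_derive h z)%C.

(* The continuation [g] is determined on the disk by [f], so the existential
   speaks of "the" continuation of the inverse. *)
Definition class_CV_Sigma (f : C -> C) : Prop :=
  class_Sigma f /\ class_CV f /\
  exists g : C -> C, inverse_continuation f g /\ class_CV g.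

(* Main.v *)
Require Import Defs.
From Stdlib Require Import Lra Classical IndefiniteDescription.

(** Only the convexity of [f] is used.  Put [p = 1 + z f'' / f'] and
    [w = (p - 1) / (p + 1) = z f'' / (2 f' + z f'')], a self-map of the disk
    vanishing at 0.  Writing [w / z = w1 + w2 z + w3 z^2 + ...], comparison of
    coefficients gives [18 (a2 a4 - a3^2) = 3 w1 w3 + 3 w1^2 w2 - 2 w2^2].  Two
    steps of Schur's algorithm give, with [t = 1 - |w1|^2], the inequalities
    [|w2| <= t] and [|t w3 + conj w1 w2^2| <= t^2 - |w2|^2], and these bound the
    right-hand side by 9/4.

    To avoid expanding quotients of power series, a bounded function is carried
    as a pair (numerator, denominator) of power series converging on the disk.
    Schwarz's lemma then needs only the maximum principle for such quotients,
    obtained from the positivity of the Laplacian of [|phi|^2 + eps |z|^2]. *)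

(** * Complex power series and their algebra *)

Definition power_sum (a : nat -> C) (z l : C) : Prop :=
  @is_series C_AbsRing C_NormedModule (fun n => (a n * z ^ n)%C) l.

Definition disk_sum (a : nat -> C) (f : C -> C) : Prop :=
  forall z : C, unit_disk z -> power_sum a z (f z).

(* [is_derive] carries the normed-module structure of its codomain, and [C] has
   two such structures that do not unify: [C_NormedModule], which [C_derive]
   expects, and [AbsRing_NormedModule C_AbsRing], which the product and chain
   rules expect. This formulation converts to either. *)
Definition has_cderiv (f : C -> C) (z l : C) : Prop :=
  forall eps : R, 0 < eps -> exists delta : R, 0 < delta /\
    forall y : C, Cmod (y - z)%C < delta ->
      Cmod (f y - f z - (y - z) * l)%C <= eps * Cmod (y - z)%C.

Lemma power_sum_pseries (a : nat -> C) (z l : C) :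
  power_sum a z l <-> @is_pseries C_AbsRing C_NormedModule a z l.
Proof.
  split; intros H; unfold power_sum, is_pseries in *;
    (eapply is_series_ext; [|exact H]); intros n.
  - exact (Cmult_comm (a n) (z ^ n)).
  - exact (Cmult_comm (z ^ n) (a n)).
Qed.

Lemma power_sum_unique (a : nat -> C) (z l l' : C) :
  power_sum a z l -> power_sum a z l' -> l = l'.
Proof.
  intros H H'.
  exact (filterlim_locally_unique (V := C_NormedModule) _ _ _ H H').
Qed.

Lemma power_sum_ext (a b : nat -> C) (z l : C) :
  (forall n, a n = b n) -> power_sum a z l -> power_sum b z l.
Proof.
  intros H. apply is_series_ext. intros n. now rewrite H.
Qed.

Lemma power_sum_plus (a b : nat -> C) (z l l' : C) :
  power_sum a z l -> power_sum b z l' ->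
  power_sum (fun n => a n + b n)%C z (l + l')%C.
Proof.
  intros H H'.
  eapply is_series_ext; [|exact (is_series_plus _ _ _ _ H H')].
  intros n. change (a n * z ^ n + b n * z ^ n = (a n + b n) * z ^ n)%C. ring.
Qed.

Lemma power_sum_scal (c : C) (a : nat -> C) (z l : C) :
  power_sum a z l -> power_sum (fun n => c * a n)%C z (c * l)%C.
Proof.
  intros H.
  eapply is_series_ext; [|exact (is_series_scal c _ _ H)].
  intros n. change (c * (a n * z ^ n) = c * a n * z ^ n)%C. ring.
Qed.

Lemma power_sum_0 (a : nat -> C) : power_sum a 0 (a 0%nat).
Proof.
  exact (proj2 (power_sum_pseries _ _ _) (is_pseries_0 (V := C_NormedModule) a)).
Qed.

Lemma power_sum_incr (a : nat -> C) (z l : C) :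
  power_sum a z l -> power_sum (PS_incr_1 (V := C_NormedModule) a) z (z * l)%C.
Proof.
  intros H. apply power_sum_pseries.
  exact (is_pseries_incr_1 (V := C_NormedModule) a z l (proj1 (power_sum_pseries _ _ _) H)).
Qed.

Lemma power_sum_shift (a : nat -> C) (z l : C) :
  z <> 0%C -> power_sum a z l ->
  power_sum (fun n => a (S n)) z ((l - a 0%nat) / z)%C.
Proof.
  intros Hz H.
  assert (H1 : @is_series C_AbsRing C_NormedModule
    (fun n => a (S n) * z ^ S n)%C (l - a 0%nat)%C).
  { apply (is_series_incr_1 (V := C_NormedModule) (fun n => a n * z ^ n)%C).
    change (power_sum a z (l - a 0%nat + a 0%nat * 1)%C).
    replace (l - a 0%nat + a 0%nat * 1)%C with l by ring. exact H. }
  replace ((l - a 0%nat) / z)%C with (/ z * (l - a 0%nat))%C by (field; assumption).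
  eapply is_series_ext; [|exact (is_series_scal (/ z)%C _ _ H1)].
  intros n. change (/ z * (a (S n) * (z * z ^ n)) = a (S n) * z ^ n)%C.
  field. assumption.
Qed.

(** * Absolute convergence and termwise differentiation *)

Lemma Cmod_series_le (u : nat -> C) (b : nat -> R) (l : C) (s : R) :
  @is_series C_AbsRing C_NormedModule u l -> is_series b s ->
  (forall n, Cmod (u n) <= b n) -> Cmod l <= s.
Proof.
  intros Hu Hb H.
  assert (L : is_lim_seq (fun n => Cmod (sum_n u n : C)) (Cmod l)).
  { apply (filterlim_comp _ _ _ _ _ _ _ _ Hu).
    exact (filterlim_norm (V := C_NormedModule) l). }
  refine (is_lim_seq_le _ _ (Cmod l) s _ L Hb).
  intros n. induction n as [|n IH].
  - rewrite !sum_O. apply H.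
  - rewrite !sum_Sn.
    eapply Rle_trans; [apply Cmod_triangle|].
    apply Rplus_le_compat; [exact IH|apply H].
Qed.

(** Convergence at the real point [r] bounds the partial sums, and each term is a difference of two
    consecutive ones. *)
Lemma disk_sum_bounded (a : nat -> C) (f : C -> C) (r : R) :
  disk_sum a f -> 0 <= r < 1 -> exists M, forall n, Rabs (Cmod (a n) * r ^ n) <= M.
Proof.
  intros H Hr.
  assert (Hz : unit_disk (RtoC r)).
  { unfold unit_disk. rewrite Cmod_R, Rabs_pos_eq; lra. }
  destruct (filterlim_bounded (V := C_NormedModule) _ (ex_intro _ _ (H _ Hz)))
    as [M HM].
  assert (HM0 : 0 <= M).
  { eapply Rle_trans; [|apply (HM 0%nat)]. apply norm_ge_0. }
  exists (M + M). intros n.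
  assert (E : Rabs (Cmod (a n) * r ^ n) = Cmod (a n * RtoC r ^ n)%C).
  { rewrite Cmod_mult, Cmod_pow, Cmod_R, (Rabs_pos_eq r) by lra.
    apply Rabs_pos_eq, Rmult_le_pos; [apply Cmod_ge_0|apply pow_le; lra]. }
  rewrite E.
  destruct n as [|n].
  - specialize (HM 0%nat). rewrite sum_O in HM.
    change (Cmod (a 0%nat * RtoC r ^ 0)%C <= M) in HM. lra.
  - assert (H1 := HM n). assert (H2 := HM (S n)).
    rewrite sum_Sn in H2.
    set (s := sum_n (fun n => (a n * RtoC r ^ n)%C) n : C) in *.
    change (Cmod s <= M) in H1.
    change (Cmod (s + a (S n) * RtoC r ^ S n)%C <= M) in H2.
    replace (a (S n) * RtoC r ^ S n)%C
      with ((s + a (S n) * RtoC r ^ S n) + - s)%C by ring.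
    eapply Rle_trans; [apply Cmod_triangle|]. rewrite Cmod_opp. lra.
Qed.

Lemma disk_sum_radius (a : nat -> C) (f : C -> C) :
  disk_sum a f -> forall r, 0 <= r < 1 -> Rbar_lt r (CV_radius (fun n => Cmod (a n))).
Proof.
  intros H r Hr.
  destruct (CV_radius_bounded (fun n => Cmod (a n))) as [Hub _].
  (* Boundedness at a radius only shows that it is at most the radius of convergence; the midpoint
     of [r] and 1 gives the strict inequality. *)
  apply Rbar_lt_le_trans with (Finite ((1 + r) / 2)); [simpl; lra|].
  apply Hub. eapply disk_sum_bounded; [exact H|lra].
Qed.

Lemma cv_abs (a : nat -> C) (z : C) :
  ex_series (fun n => Cmod (a n) * Cmod z ^ n) ->
  exists l, power_sum a z l.
Proof.
  intros H.
  refine (ex_series_le (V := C_CompleteNormedModule) (fun n => (a n * z ^ n)%C) _ _ H).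
  intros n. change (Cmod (a n * z ^ n)%C <= Cmod (a n) * Cmod z ^ n).
  rewrite Cmod_mult, Cmod_pow. lra.
Qed.

Lemma disk_sum_exists (a : nat -> C) :
  (forall z, unit_disk z -> exists l, power_sum a z l) -> exists f, disk_sum a f.
Proof.
  intros H.
  assert (H' : forall z, exists l, unit_disk z -> power_sum a z l).
  { intros z. unfold unit_disk.
    destruct (Rlt_dec (Cmod z) 1) as [h|h].
    - destruct (H z h) as [l Hl]. now exists l.
    (* Off the disk the implication is vacuous, so 0 is only a dummy value. *)
    - exists 0%C. intros; contradiction. }
  apply functional_choice in H'. exact H'.
Qed.

(** The factor [(n+1)(n+2)] is that of the second formal derivative, so for [rho < 1] these bounds
    remain summable when weighted by the coefficients of a series converging on the disk. *)
Lemma pow_taylor_bound (y z : C) (rho : R) (n : nat) :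
  Cmod y <= rho -> Cmod z <= rho ->
  Cmod (y ^ S (S n) - z ^ S (S n) - INR (S (S n)) * (y - z) * z ^ S n)%C
    <= Cmod (y - z)%C ^ 2 * (INR (S n) * INR (S (S n)) * rho ^ n).
Proof.
  intros Hy Hz. assert (Hrho : 0 <= rho) by (assert (h := Cmod_ge_0 y); lra).
  (* The remainders satisfy [T (n+1) = y T n + n (y - z)^2 z^(n-1)]. *)
  induction n as [|n IH].
  - replace (y ^ 2 - z ^ 2 - INR 2 * (y - z) * z ^ 1)%C with ((y - z) ^ 2)%C
      by (simpl; rewrite RtoC_plus; ring).
    rewrite Cmod_pow. assert (h := pow2_ge_0 (Cmod (y - z)%C)). simpl INR. simpl pow in *. lra.
  - set (T := (y ^ S (S n) - z ^ S (S n) - INR (S (S n)) * (y - z) * z ^ S n)%C) in *.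
    replace (y ^ S (S (S n)) - z ^ S (S (S n))
        - INR (S (S (S n))) * (y - z) * z ^ S (S n))%C
      with (y * T + INR (S (S n)) * (y - z) ^ 2 * z ^ S n)%C.
    2:{ unfold T. rewrite (S_INR (S (S n))), RtoC_plus, !Cpow_S. ring. }
    eapply Rle_trans; [apply Cmod_triangle|].
    rewrite !Cmod_mult, !Cmod_pow, Cmod_R, Rabs_pos_eq by apply pos_INR.
    set (d := Cmod (y - z)%C ^ 2) in *.
    assert (Hd : 0 <= d) by apply pow2_ge_0. clearbody d.
    assert (Hp : 0 <= rho ^ n) by (apply pow_le; lra).
    assert (H1 : Cmod y * Cmod T <= rho * (d * (INR (S n) * INR (S (S n)) * rho ^ n))).
    { apply Rmult_le_compat; auto using Cmod_ge_0. }
    assert (H2 : Cmod z ^ S n <= rho ^ S n).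
    { apply pow_incr. split; [apply Cmod_ge_0|assumption]. }
    assert (H3 : INR (S (S n)) * d * Cmod z ^ S n <= INR (S (S n)) * d * rho ^ S n).
    { apply Rmult_le_compat_l; [|assumption].
      apply Rmult_le_pos; [apply pos_INR|assumption]. }
    assert (H4 : 0 <= d * (INR (S (S n)) * rho ^ S n)).
    { repeat apply Rmult_le_pos; auto using pos_INR, pow_le. }
    rewrite (S_INR (S (S n))). simpl (rho ^ S n) in *.
    assert (E : INR (S (S n)) = INR (S n) + 1) by apply S_INR.
    nra.
Qed.

Definition cdiff (a : nat -> C) (n : nat) : C := (INR (S n) * a (S n))%C.

(** Summing the Taylor remainders of the monomials bounds the remainder of [f] at [z] by
    [K |y - z|^2], with one constant [K] for all [|y| <= rho]. *)
Lemma disk_sum_derive (a : nat -> C) (f : C -> C) :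
  disk_sum a f ->
  exists f', disk_sum (cdiff a) f' /\
    forall z, unit_disk z -> has_cderiv f z (f' z).
Proof.
  intros H.
  destruct (disk_sum_exists (cdiff a)) as [f' Hf'].
  { intros z Hz. apply cv_abs.
    assert (Hcv := disk_sum_radius a f H (Cmod z) (conj (Cmod_ge_0 z) Hz)).
    rewrite <- CV_radius_derive in Hcv.
    eapply ex_series_ext; [|apply (CV_disk_inside (PS_derive (fun n => Cmod (a n))) (Cmod z))].
    - intros n. unfold PS_derive, cdiff. cbv beta.
      rewrite Cmod_mult, Cmod_R, (Rabs_pos_eq (INR _)) by apply pos_INR.
      apply Rabs_pos_eq. repeat apply Rmult_le_pos; auto using pos_INR, Cmod_ge_0, pow_le.
    - rewrite Rabs_pos_eq by apply Cmod_ge_0. exact Hcv. }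
  exists f'. split; [exact Hf'|].
  intros z Hz.
  (* The midpoint of [|z|] and 1 leaves a neighbourhood of [z] of radius [(1 - |z|) / 2] inside the
     disk of radius [rho]. *)
  set (rho := (1 + Cmod z) / 2).
  assert (Hz0 := Cmod_ge_0 z). unfold unit_disk in Hz.
  assert (Hrho : 0 <= rho < 1) by (unfold rho; lra).
  set (b := fun n => INR (S n) * INR (S (S n)) * rho ^ n * Cmod (a (S (S n)))).
  assert (Hb : ex_series b).
  { assert (Hcv := disk_sum_radius a f H rho Hrho).
    rewrite <- CV_radius_derive, <- CV_radius_derive in Hcv.
    eapply ex_series_ext; [|apply (CV_disk_inside (PS_derive (PS_derive (fun n => Cmod (a n)))) rho)].
    - intros n. unfold PS_derive, b. cbv beta.
      rewrite Rabs_pos_eq; [match goal with |- ?x = ?y => change (@eq R x y) end; ring|].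
      repeat apply Rmult_le_pos; try apply pow_le; auto using pos_INR, Cmod_ge_0. lra.
    - rewrite Rabs_pos_eq by lra. exact Hcv. }
  assert (Hb0 : forall n, 0 <= b n).
  { intros n. unfold b.
    repeat apply Rmult_le_pos; try apply pow_le; auto using pos_INR, Cmod_ge_0. lra. }
  destruct Hb as [K HK].
  assert (Key : forall y, Cmod y <= rho ->
    Cmod (f y - f z - (y - z) * f' z)%C <= Cmod (y - z)%C ^ 2 * K).
  { intros y Hy.
    assert (S1 : power_sum a y (f y)) by (apply H; unfold unit_disk; lra).
    assert (S2 : power_sum a z (f z)) by (apply H; assumption).
    assert (S3 := Hf' z Hz). unfold power_sum in S1, S2, S3.
    assert (S4 : @is_series C_AbsRing C_NormedModule
      (fun n => (a n * (y ^ n - z ^ n))%C) (f y - f z)%C).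
    { eapply is_series_ext; [|exact (is_series_minus _ _ _ _ S1 S2)].
      intros n. change (a n * y ^ n + - (a n * z ^ n) = a n * (y ^ n - z ^ n))%C. ring. }
    (* The terms of degree 0 and 1 contribute nothing to the remainder. They are dropped one at a
       time, the first before subtracting the derivative series, whose indices are shifted by
       one. *)
    assert (S5 : @is_series C_AbsRing C_NormedModule
      (fun n => (a (S n) * (y ^ S n - z ^ S n))%C) (f y - f z)%C).
    { apply (is_series_incr_1 (V := C_NormedModule) (fun n => a n * (y ^ n - z ^ n))%C).
      change (@is_series C_AbsRing C_NormedModule
        (fun n => (a n * (y ^ n - z ^ n))%C) (f y - f z + a 0%nat * (RtoC 1 - RtoC 1))%C).
      replace (f y - f z + a 0%nat * (RtoC 1 - RtoC 1))%C with (f y - f z)%C by ring.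
      exact S4. }
    assert (S6 : @is_series C_AbsRing C_NormedModule
      (fun n => (a (S n) * (y ^ S n - z ^ S n - INR (S n) * (y - z) * z ^ n))%C)
      (f y - f z - (y - z) * f' z)%C).
    { eapply is_series_ext;
        [|exact (is_series_minus _ _ _ _ S5 (is_series_scal (y - z)%C _ _ S3))].
      intros n. unfold cdiff.
      change (a (S n) * (y ^ S n - z ^ S n) + - ((y - z) * (INR (S n) * a (S n) * z ^ n))
        = a (S n) * (y ^ S n - z ^ S n - INR (S n) * (y - z) * z ^ n))%C.
      ring. }
    assert (S7 : @is_series C_AbsRing C_NormedModule
      (fun n => (a (S (S n)) * (y ^ S (S n) - z ^ S (S n) - INR (S (S n)) * (y - z) * z ^ S n))%C)
      (f y - f z - (y - z) * f' z)%C).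
    { apply (is_series_incr_1 (V := C_NormedModule)
        (fun n => (a (S n) * (y ^ S n - z ^ S n - INR (S n) * (y - z) * z ^ n))%C)).
      change (@is_series C_AbsRing C_NormedModule
        (fun n => (a (S n) * (y ^ S n - z ^ S n - INR (S n) * (y - z) * z ^ n))%C)
        (f y - f z - (y - z) * f' z +
          a 1%nat * (y * RtoC 1 - z * RtoC 1 - RtoC 1 * (y - z) * RtoC 1))%C).
      replace (f y - f z - (y - z) * f' z +
          a 1%nat * (y * RtoC 1 - z * RtoC 1 - RtoC 1 * (y - z) * RtoC 1))%C
        with (f y - f z - (y - z) * f' z)%C by ring.
      exact S6. }
    eapply Cmod_series_le; [exact S7|exact (is_series_scal (Cmod (y - z)%C ^ 2) _ _ HK)|].
    intros n.
    change (Cmod (a (S (S n)) * (y ^ S (S n) - z ^ S (S n) - INR (S (S n)) * (y - z) * z ^ S n))%C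
      <= Cmod (y - z)%C ^ 2 * b n).
    rewrite Cmod_mult.
    assert (P := pow_taylor_bound y z rho n Hy ltac:(unfold rho; lra)).
    apply Rmult_le_compat_l with (r := Cmod (a (S (S n)))) in P; [|apply Cmod_ge_0].
    unfold b. eapply Rle_trans; [exact P|]. apply Req_le. ring. }
  assert (HK0 : 0 <= K).
  { assert (is_lim_seq (sum_n b) K) by exact HK.
    refine (is_lim_seq_le (fun _ => 0) _ 0 K _ (is_lim_seq_const 0) H0).
    intros n. induction n as [|n IH].
    - rewrite sum_O. apply Hb0.
    - rewrite sum_Sn. apply Rplus_le_le_0_compat; [exact IH|apply Hb0]. }
  intros eps Heps.
  (* The first bound keeps [|y| <= rho], the second makes [K |y - z| <= eps]; [K + 1] avoids
     division by zero. *)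
  exists (Rmin ((1 - Cmod z) / 2) (eps / (K + 1))).
  assert (Hd : 0 < eps / (K + 1)) by (apply Rdiv_lt_0_compat; lra).
  split; [apply Rmin_glb_lt; lra|].
  intros y Hy.
  assert (Hy1 := Rlt_le_trans _ _ _ Hy (Rmin_l _ _)).
  assert (Hy2 := Rlt_le_trans _ _ _ Hy (Rmin_r _ _)).
  assert (Hyr : Cmod y <= rho).
  { replace y with ((y - z) + z)%C by ring.
    eapply Rle_trans; [apply Cmod_triangle|]. unfold rho. lra. }
  eapply Rle_trans; [apply (Key y Hyr)|].
  assert (Hm := Cmod_ge_0 (y - z)%C).
  assert (Cmod (y - z)%C * K <= eps).
  { apply Rle_trans with (eps / (K + 1) * K).
    - apply Rmult_le_compat_r; lra.
    - apply Rmult_le_reg_r with (K + 1); [lra|]. field_simplify; nra. }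
  replace (Cmod (y - z)%C ^ 2 * K) with (Cmod (y - z)%C * K * Cmod (y - z)%C) by ring.
  apply Rmult_le_compat_r; assumption.
Qed.

(** * Rules of complex differentiation *)

Lemma Im_le_Cmod (z : C) : Rabs (Im z) <= Cmod z.
Proof. eapply Rle_trans; [apply Rmax_r|apply Rmax_Cmod]. Qed.

Lemma has_cderiv_is_derive (f : C -> C) (z l : C) :
  has_cderiv f z l -> @is_derive C_AbsRing C_NormedModule f z l.
Proof.
  intros H. split; [apply is_linear_scal_l|].
  intros x Hx. apply (is_filter_lim_locally_unique (V := AbsRing_NormedModule C_AbsRing)) in Hx.
  intros eps. destruct (H eps (cond_pos eps)) as [d [Hd Hy]].
  exists (mkposreal d Hd). intros y Hb.
  rewrite <- Hx. exact (Hy y Hb).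
Qed.

Lemma is_derive_has_cderiv (f : C -> C) (z l : C) :
  @is_derive C_AbsRing (AbsRing_NormedModule C_AbsRing) f z l -> has_cderiv f z l.
Proof.
  intros [_ H] eps Heps.
  destruct (H z (fun P HP => HP) (mkposreal eps Heps)) as [d Hd].
  exists d. split; [apply cond_pos|]. intros y Hy. exact (Hd y Hy).
Qed.

Lemma has_cderiv_is_derive_K (f : C -> C) (z l : C) :
  has_cderiv f z l -> @is_derive C_AbsRing (AbsRing_NormedModule C_AbsRing) f z l.
Proof.
  intros H. split; [apply is_linear_scal_l|].
  intros x Hx. apply (is_filter_lim_locally_unique (V := AbsRing_NormedModule C_AbsRing)) in Hx.
  intros eps. destruct (H eps (cond_pos eps)) as [d [Hd Hy]].
  exists (mkposreal d Hd). intros y Hb.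
  rewrite <- Hx. exact (Hy y Hb).
Qed.

Lemma has_cderiv_C_derive (f : C -> C) (z l : C) :
  has_cderiv f z l -> C_derive f z = l.
Proof. intros H. apply is_C_derive_unique, has_cderiv_is_derive, H. Qed.

Lemma has_cderiv_mult (f g : C -> C) (z f' g' : C) :
  has_cderiv f z f' -> has_cderiv g z g' ->
  has_cderiv (fun y => f y * g y)%C z (f' * g z + f z * g')%C.
Proof.
  intros Hf Hg. apply is_derive_has_cderiv.
  apply (is_derive_mult (K := C_AbsRing) f g z f' g');
    [now apply has_cderiv_is_derive_K|now apply has_cderiv_is_derive_K|].
  exact Cmult_comm.
Qed.

Lemma has_cderiv_ext (f g : C -> C) (z l : C) (r : R) :
  0 < r -> (forall y, Cmod (y - z)%C < r -> f y = g y) ->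
  has_cderiv f z l -> has_cderiv g z l.
Proof.
  intros Hr E H eps Heps. destruct (H eps Heps) as [d [Hd Hy]].
  exists (Rmin d r). split; [now apply Rmin_glb_lt|].
  intros y h. assert (h1 := Rlt_le_trans _ _ _ h (Rmin_l _ _)).
  assert (h2 := Rlt_le_trans _ _ _ h (Rmin_r _ _)).
  rewrite <- !E; auto. replace (z - z)%C with (RtoC 0) by ring.
  now rewrite Cmod_0.
Qed.

Lemma has_cderiv_comp (f g : C -> C) (z f' g' : C) :
  has_cderiv f (g z) f' -> has_cderiv g z g' ->
  has_cderiv (fun y => f (g y)) z (g' * f')%C.
Proof.
  intros Hf Hg. apply is_derive_has_cderiv.
  apply (is_derive_comp (K := C_AbsRing) (V := AbsRing_NormedModule C_AbsRing) f g z f' g');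
    now apply has_cderiv_is_derive_K.
Qed.

Lemma Cmod_triangle_rev (x y : C) : Cmod x <= Cmod y + Cmod (x - y)%C.
Proof.
  replace x with (y + (x - y))%C at 1 by ring. apply Cmod_triangle.
Qed.

(** The remainder is exactly [(y - z)^2 / (y z^2)]. Once [|y - z| < |z| / 2], the denominator has
    modulus at least [|z|^3 / 2]. *)
Lemma has_cderiv_inv (z : C) :
  z <> 0%C -> has_cderiv Cinv z (- / (z * z))%C.
Proof.
  intros Hz eps Heps.
  assert (Hm : 0 < Cmod z) by now apply Cmod_gt_0.
  set (m := Cmod z) in *.
  assert (Hm3 : 0 < m ^ 3 / 2) by (assert (h := pow_lt m 3 Hm); lra).
  exists (Rmin (m / 2) (eps * (m ^ 3 / 2))).
  split; [apply Rmin_glb_lt; [lra|nra]|].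
  intros y Hy. assert (h1 := Rlt_le_trans _ _ _ Hy (Rmin_l _ _)).
  assert (h2 := Rlt_le_trans _ _ _ Hy (Rmin_r _ _)).
  assert (Hym : m / 2 < Cmod y).
  { assert (h := Cmod_triangle_rev z y). fold m in h.
    replace (z - y)%C with (- (y - z))%C in h by ring. rewrite Cmod_opp in h. lra. }
  assert (Hy0 : y <> 0%C) by (apply Cmod_gt_0; lra).
  replace (/ y - / z - (y - z) * - / (z * z))%C
    with ((y - z) * (y - z) / (y * z * z))%C by (field; auto).
  rewrite Cmod_div by (repeat apply Cmult_neq_0; auto).
  rewrite !Cmod_mult. fold m. set (d := Cmod (y - z)%C) in *.
  assert (Hd : 0 <= d) by apply Cmod_ge_0.
  apply Rmult_le_reg_r with (Cmod y * m * m); [nra|].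
  unfold Rdiv. rewrite Rmult_assoc, Rinv_l by nra.
  rewrite Rmult_1_r.
  assert (m ^ 3 / 2 <= Cmod y * m * m) by (simpl; nra).
  assert (d <= eps * (Cmod y * m * m)) by nra.
  nra.
Qed.

Lemma has_cderiv_div (f g : C -> C) (z f' g' : C) :
  has_cderiv f z f' -> has_cderiv g z g' -> g z <> 0%C ->
  has_cderiv (fun y => f y / g y)%C z ((f' * g z - f z * g') / (g z * g z))%C.
Proof.
  intros Hf Hg H0.
  assert (H := has_cderiv_mult _ _ _ _ _ Hf
    (has_cderiv_comp Cinv g z _ _ (has_cderiv_inv _ H0) Hg)).
  replace ((f' * g z - f z * g') / (g z * g z))%C
    with (f' * / g z + f z * (g' * - / (g z * g z)))%C by (field; assumption).
  exact H.
Qed.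

Lemma has_cderiv_continuous (f : C -> C) (z l : C) :
  has_cderiv f z l -> forall eps, 0 < eps -> exists delta, 0 < delta /\
    forall y, Cmod (y - z)%C < delta -> Cmod (f y - f z)%C < eps.
Proof.
  intros H eps Heps. destruct (H 1 Rlt_0_1) as [d [Hd Hy]].
  assert (Hl := Cmod_ge_0 l).
  exists (Rmin d (eps / (Cmod l + 1))).
  assert (Hq : 0 < eps / (Cmod l + 1)) by (apply Rdiv_lt_0_compat; lra).
  split; [now apply Rmin_glb_lt|].
  intros y h. assert (h1 := Rlt_le_trans _ _ _ h (Rmin_l _ _)).
  assert (h2 := Rlt_le_trans _ _ _ h (Rmin_r _ _)).
  specialize (Hy y h1).
  eapply Rle_lt_trans; [apply (Cmod_triangle_rev _ ((y - z) * l)%C)|].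
  rewrite Cmod_mult.
  apply Rmult_lt_compat_r with (r := Cmod l + 1) in h2; [|lra].
  replace (eps / (Cmod l + 1) * (Cmod l + 1)) with eps in h2 by (field; lra).
  lra.
Qed.

(** * Real derivatives along lines in the plane *)

(** Treats [Re] and [Im] at once: a real-linear functional bounded by the modulus passes through the
    difference quotient. *)
Lemma line_derive_aux (p : C -> R) (f : C -> C) (z d l : C) (t : R) :
  (forall x y, p (x - y)%C = p x - p y) -> (forall (s : R) x, p (s * x)%C = s * p x) ->
  (forall x, Rabs (p x) <= Cmod x) ->
  has_cderiv f (z + t * d)%C l ->
  is_derive (fun s : R => p (f (z + s * d)%C)) t (p (d * l)%C).
Proof.
  intros Hm Hs Hp H. split; [apply is_linear_scal_l|].
  intros x Hx. apply (is_filter_lim_locally_unique (V := AbsRing_NormedModule R_AbsRing)) in Hx. subst x.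
  intros eps. assert (Hd0 := Cmod_ge_0 d). assert (He := cond_pos eps).
  destruct (H (eps / (Cmod d + 1))) as [r [Hr Hy]].
  { apply Rdiv_lt_0_compat; lra. }
  assert (Hq : 0 < r / (Cmod d + 1)) by (apply Rdiv_lt_0_compat; lra).
  exists (mkposreal _ Hq). intros s Hb.
  change (Rabs (s - t) < r / (Cmod d + 1)) in Hb.
  change (Rabs (p (f (z + s * d)%C) - p (f (z + t * d)%C) - (s - t) * p (d * l)%C)
    <= eps * Rabs (s - t)).
  rewrite <- Hm, <- Hs, <- Hm.
  eapply Rle_trans; [apply Hp|].
  assert (E : Cmod (z + s * d - (z + t * d))%C = Rabs (s - t) * Cmod d).
  { rewrite <- Cmod_R, <- Cmod_mult. f_equal. rewrite RtoC_minus. ring. }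
  assert (Ha := Rabs_pos (s - t)).
  assert (Hlt : Cmod (z + s * d - (z + t * d))%C < r).
  { rewrite E. apply Rmult_lt_compat_r with (r := Cmod d + 1) in Hb; [|lra].
    replace (r / (Cmod d + 1) * (Cmod d + 1)) with r in Hb by (field; lra). nra. }
  specialize (Hy _ Hlt). rewrite E in Hy.
  replace (RtoC (s - t) * (d * l))%C with ((z + s * d - (z + t * d)) * l)%C
    by (rewrite RtoC_minus; ring).
  eapply Rle_trans; [exact Hy|].
  apply Rmult_le_reg_r with (Cmod d + 1); [lra|].
  replace (eps / (Cmod d + 1) * (Rabs (s - t) * Cmod d) * (Cmod d + 1))
    with (eps * Rabs (s - t) * Cmod d) by (field; lra).
  assert (0 <= eps * Rabs (s - t)) by (apply Rmult_le_pos; lra). nra.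
Qed.

(** Conjugation is not complex differentiable, but [Re (f * Cconj g)] is the real inner product of
    [f] and [g], so two real product rules suffice. *)
Lemma line_derive_prod (f g : C -> C) (z d f' g' : C) (t : R) :
  has_cderiv f (z + t * d)%C f' -> has_cderiv g (z + t * d)%C g' ->
  is_derive (fun s : R => Re (f (z + s * d) * Cconj (g (z + s * d)))%C) t
    (Re (d * f' * Cconj (g (z + t * d)) + f (z + t * d) * Cconj (d * g'))%C).
Proof.
  intros Hf Hg.
  assert (HR : forall h h', has_cderiv h (z + t * d)%C h' ->
    is_derive (fun s : R => Re (h (z + s * d)%C)) t (Re (d * h')%C)).
  { intros h h' Hh. apply line_derive_aux; auto using re_le_Cmod.
    intros s x. apply re_scal_l. }
  assert (HI : forall h h', has_cderiv h (z + t * d)%C h' ->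
    is_derive (fun s : R => Im (h (z + s * d)%C)) t (Im (d * h')%C)).
  { intros h h' Hh. apply line_derive_aux; auto using Im_le_Cmod.
    intros s x. apply im_scal_l. }
  assert (H1 := is_derive_mult (K := R_AbsRing) _ _ _ _ _ (HR _ _ Hf) (HR _ _ Hg) Rmult_comm).
  assert (H2 := is_derive_mult (K := R_AbsRing) _ _ _ _ _ (HI _ _ Hf) (HI _ _ Hg) Rmult_comm).
  assert (H3 := is_derive_plus (K := R_AbsRing) _ _ _ _ _ H1 H2).
  assert (E : forall x y, Re (x * Cconj y)%C = Re x * Re y + Im x * Im y).
  { intros x y. rewrite re_mult, re_conj, im_conj. ring. }
  rewrite re_plus, !E.
  eapply is_derive_ext;
    [|match type of H3 with is_derive _ _ ?u => match goal with |- is_derive _ _ ?v =>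
       replace v with u; [exact H3|] end end].
  - intros s. cbv beta. symmetry. apply E.
  - unfold plus, mult; simpl. unfold Re, Im. simpl. ring.
Qed.

(** * Compactness of closed disks *)

(** A property that survives shrinking [d] and holds locally holds with a single [d], by compactness
    of the square [[-r, r]^2]; centres outside the disk get a neighbourhood missing the disk. *)
Lemma disk_uniform (r : R) (P : R -> C -> Prop) :
  (forall d d' y, P d y -> d' <= d -> 0 < d' -> P d' y) ->
  (forall w, Cmod w <= r -> exists d, 0 < d /\
     forall y, Cmod y <= r -> Cmod (y - w)%C < d -> P d y) ->
  exists d, 0 < d /\ forall y, Cmod y <= r -> P d y.
Proof.
  intros Hmon Hloc.
  (* Compactness controls each coordinate by [d], hence the modulus by [2 * d]. *)
  assert (Hall : forall w : C, exists d : posreal,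
    forall y, Cmod y <= r -> Cmod (y - w)%C < 2 * d -> P d y).
  { intros w. destruct (Rle_dec (Cmod w) r) as [h|h].
    - destruct (Hloc w h) as [d [Hd H]].
      assert (Hd2 : 0 < d / 2) by lra.
      exists (mkposreal _ Hd2). simpl. intros y Hy Hyw.
      apply (Hmon d); [|lra|lra]. apply H; [assumption|lra].
    - assert (Hd2 : 0 < (Cmod w - r) / 2) by lra.
      exists (mkposreal _ Hd2). simpl. intros y Hy Hyw.
      assert (t := Cmod_triangle_rev w y).
      replace (w - y)%C with (- (y - w))%C in t by ring.
      rewrite Cmod_opp in t. lra. }
  apply functional_choice in Hall. destruct Hall as [delta Hdelta].
  destruct (compactness_value_2d (- r) r (- r) r (fun u v => delta (u, v))) as [d Hd].
  exists d. split; [apply cond_pos|].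
  intros [x y] Hy.
  assert (Bx := Rle_trans _ _ _ (re_le_Cmod (x, y)) Hy).
  assert (By := Rle_trans _ _ _ (Im_le_Cmod (x, y)) Hy).
  simpl in Bx, By. apply Rabs_le_between in Bx, By.
  (* [compactness_value_2d] yields its covering point only under a double negation. *)
  apply NNPP. intros Hn. apply (Hd x y Bx By). intros (u & v & _ & _ & Hu & Hv & Hle).
  apply Hn. apply (Hmon (delta (u, v))); [|assumption|apply cond_pos].
  apply Hdelta; [assumption|].
  replace ((x, y) - (u, v))%C with (RtoC (x - u) + Ci * RtoC (y - v))%C.
  2:{ apply injective_projections; simpl; ring. }
  eapply Rle_lt_trans; [apply Cmod_triangle|].
  rewrite Cmod_mult, Cmod_Ci, !Cmod_R. lra.
Qed.

(** [disk_uniform] is used twice: for a global bound, written [/ d] so that it weakens as [d]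
    shrinks, and then, if the supremum [S] were not attained, for a uniform gap [F y <= S - d],
    which contradicts leastness of [S]. *)
Lemma disk_max (r : R) (F : C -> R) :
  0 <= r ->
  (forall w, Cmod w <= r -> forall eps, 0 < eps -> exists d, 0 < d /\
     forall y, Cmod (y - w)%C < d -> Rabs (F y - F w) < eps) ->
  exists w, Cmod w <= r /\ forall y, Cmod y <= r -> F y <= F w.
Proof.
  intros Hr Hc.
  assert (Hbd : exists d, 0 < d /\ forall y, Cmod y <= r -> F y <= / d).
  { apply (disk_uniform r (fun d y => F y <= / d)).
    - intros d d' y H h h'. eapply Rle_trans; [exact H|]. now apply Rinv_le_contravar.
    - intros w Hw. destruct (Hc w Hw 1 Rlt_0_1) as [d [Hd H]].
      assert (Hp : 0 < Rabs (F w) + 1) by (assert (h := Rabs_pos (F w)); lra).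
      exists (Rmin d (/ (Rabs (F w) + 1))).
      assert (Hi := Rinv_0_lt_compat _ Hp).
      split; [now apply Rmin_glb_lt|]. intros y _ Hy.
      assert (h1 := Rlt_le_trans _ _ _ Hy (Rmin_l _ _)).
      specialize (H y h1). apply Rabs_lt_between in H.
      assert (h2 := Rle_abs (F w)).
      apply Rle_trans with (Rabs (F w) + 1); [lra|].
      rewrite <- (Rinv_inv (Rabs (F w) + 1)) at 1.
      apply Rinv_le_contravar; [now apply Rmin_glb_lt|apply Rmin_r]. }
  destruct Hbd as [d0 [Hd0 Hbd]].
  destruct (completeness (fun v => exists y, Cmod y <= r /\ F y = v)) as [S [HS1 HS2]].
  { exists (/ d0). intros v (y & Hy & <-). auto. }
  { exists (F 0%C). exists 0%C. rewrite Cmod_0. auto. }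
  apply NNPP. intros Hn.
  assert (Hlt : forall w, Cmod w <= r -> F w < S).
  { intros w Hw. apply Rnot_le_lt. intros h. apply Hn. exists w. split; [assumption|].
    intros y Hy. apply Rle_trans with S; [|assumption]. apply HS1. now exists y. }
  assert (Hgap : exists d, 0 < d /\ forall y, Cmod y <= r -> F y <= S - d).
  { apply (disk_uniform r (fun d y => F y <= S - d)).
    - intros d d' y H h _. lra.
    - intros w Hw. specialize (Hlt w Hw).
      destruct (Hc w Hw ((S - F w) / 2)) as [d [Hd H]]; [lra|].
      exists (Rmin d ((S - F w) / 2)). split; [apply Rmin_glb_lt; lra|].
      intros y _ Hy. assert (h1 := Rlt_le_trans _ _ _ Hy (Rmin_l _ _)).
      specialize (H y h1). apply Rabs_lt_between in H.
      assert (h2 := Rmin_r d ((S - F w) / 2)). lra. }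
  destruct Hgap as [d [Hd Hgap]].
  assert (S <= S - d); [|lra].
  apply HS2. intros v (y & Hy & <-). auto.
Qed.

(** * The maximum principle *)

(** Near 0 the slope [G1 t] differs from [G1 0 + t L] by at most [L |t| / 2]. So if [G1 0 >= 0] then
    [G] rises to the right of 0, and otherwise it rises to the left, by the mean value theorem. *)
Lemma no_strictly_convex_max (G G1 : R -> R) (L r : R) :
  0 < r -> (forall t, Rabs t < r -> is_derive G t (G1 t)) ->
  is_derive G1 0 L -> 0 < L ->
  ~ (forall t, Rabs t < r -> G t <= G 0).
Proof.
  intros Hr HG HG1 HL Hmax.
  destruct HG1 as [_ H1].
  destruct (H1 0 (fun P HP => HP) (mkposreal (L / 2) ltac:(lra))) as [d Hd].
  assert (Hd' : forall t, Rabs t < d -> Rabs (G1 t - G1 0 - t * L) <= L / 2 * Rabs t).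
  { intros t Ht. assert (E : t = t - 0) by ring. rewrite E in Ht.
    specialize (Hd t Ht).
    change (Rabs (G1 t - G1 0 - (t - 0) * L) <= L / 2 * Rabs (t - 0)) in Hd.
    rewrite <- E in Hd. exact Hd. }
  assert (Hdp := cond_pos d). set (d0 := pos d) in *. clearbody d0.
  assert (Hs : exists s, 0 < s /\ s < d0 /\ s < r).
  { exists (Rmin d0 r / 2). assert (h := Rmin_glb_lt _ _ _ Hdp Hr).
    assert (h1 := Rmin_l d0 r). assert (h2 := Rmin_r d0 r). lra. }
  destruct Hs as (s & Hs0 & Hsd & Hsr).
  assert (Hcont : forall t, Rabs t < r -> continuity_pt G t).
  { intros t Ht. apply derivable_continuous_pt. exists (G1 t).
    apply is_derive_Reals. auto. }
  destruct (Rle_lt_dec 0 (G1 0)) as [h|h].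
  - destruct (MVT_cor2 G G1 0 s Hs0) as (c & Hc & Hc1).
    { intros c Hc. apply is_derive_Reals, HG. rewrite Rabs_pos_eq; lra. }
    assert (K := Hd' c). assert (M := Hmax s).
    rewrite Rabs_pos_eq in K, M by lra.
    specialize (K ltac:(lra)). specialize (M Hsr).
    apply Rabs_le_between in K. assert (0 < G1 c) by nra. nra.
  - destruct (MVT_cor2 G G1 (- s) 0 ltac:(lra)) as (c & Hc & Hc1).
    { intros c Hc. apply is_derive_Reals, HG. rewrite Rabs_left1; lra. }
    assert (K := Hd' c). assert (M := Hmax (- s)).
    rewrite Rabs_left1 in K, M by lra.
    specialize (K ltac:(lra)). specialize (M ltac:(lra)).
    apply Rabs_le_between in K. assert (G1 c < 0) by nra. nra.
Qed.

Lemma Cmod_sqr (z : C) : Cmod z ^ 2 = Re (z * Cconj z)%C.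
Proof. rewrite Cmod2_alt, re_mult, re_conj, im_conj. ring. Qed.

Lemma Cmod_sqr_continuous (f : C -> C) (z l : C) :
  has_cderiv f z l -> forall eps, 0 < eps -> exists delta, 0 < delta /\
    forall y, Cmod (y - z)%C < delta -> Rabs (Cmod (f y) ^ 2 - Cmod (f z) ^ 2) < eps.
Proof.
  intros H eps Heps.
  assert (Hm := Cmod_ge_0 (f z)). set (m := Cmod (f z)) in *.
  assert (Hq : 0 < eps / (2 * m + 2)) by (apply Rdiv_lt_0_compat; lra).
  destruct (has_cderiv_continuous f z l H (Rmin 1 (eps / (2 * m + 2)))) as [d [Hd Hy]].
  { apply Rmin_glb_lt; lra. }
  exists d. split; [assumption|]. intros y hy. specialize (Hy y hy).
  assert (h1 := Rlt_le_trans _ _ _ Hy (Rmin_l _ _)).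
  assert (h2 := Rlt_le_trans _ _ _ Hy (Rmin_r _ _)).
  assert (t1 := Cmod_triangle_rev (f y) (f z)).
  assert (t2 := Cmod_triangle_rev (f z) (f y)).
  replace (f z - f y)%C with (- (f y - f z))%C in t2 by ring.
  rewrite Cmod_opp in t2. fold m in t1, t2.
  assert (Hy0 := Cmod_ge_0 (f y)). set (k := Cmod (f y)) in *.
  set (e := Cmod (f y - f z)%C) in *. clearbody k e m.
  apply Rmult_lt_compat_r with (r := 2 * m + 2) in h2; [|lra].
  replace (eps / (2 * m + 2) * (2 * m + 2)) with eps in h2 by (field; lra).
  apply Rabs_def1; nra.
Qed.

Lemma has_cderiv_scal (c : C) (f : C -> C) (z l : C) :
  has_cderiv f z l -> has_cderiv (fun y => c * f y)%C z (c * l)%C.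
Proof.
  intros H eps Heps. assert (Hc := Cmod_ge_0 c).
  destruct (H (eps / (Cmod c + 1))) as [d [Hd Hy]].
  { apply Rdiv_lt_0_compat; lra. }
  exists d. split; [assumption|]. intros y h.
  replace (c * f y - c * f z - (y - z) * (c * l))%C
    with (c * (f y - f z - (y - z) * l))%C by ring.
  rewrite Cmod_mult. specialize (Hy y h).
  assert (Hn := Cmod_ge_0 (y - z)%C).
  apply Rle_trans with (Cmod c * (eps / (Cmod c + 1) * Cmod (y - z)%C)).
  - now apply Rmult_le_compat_l.
  - apply Rmult_le_reg_r with (Cmod c + 1); [lra|].
    replace (Cmod c * (eps / (Cmod c + 1) * Cmod (y - z)%C) * (Cmod c + 1))
      with (Cmod c * (eps * Cmod (y - z)%C)) by (field; lra).
    assert (0 <= eps * Cmod (y - z)%C) by (apply Rmult_le_pos; lra). nra.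
Qed.

Lemma has_cderiv_id (z : C) : has_cderiv (fun y => y) z 1%C.
Proof.
  intros eps Heps. exists 1. split; [lra|]. intros y _.
  replace (y - z - (y - z) * 1)%C with (RtoC 0) by ring. rewrite Cmod_0.
  apply Rmult_le_pos; [lra|apply Cmod_ge_0].
Qed.

Lemma has_cderiv_const (c z : C) : has_cderiv (fun _ => c) z 0%C.
Proof.
  intros eps Heps. exists 1. split; [lra|]. intros y _.
  replace (c - c - (y - z) * 0)%C with (RtoC 0) by ring. rewrite Cmod_0.
  apply Rmult_le_pos; [lra|apply Cmod_ge_0].
Qed.

Lemma has_cderiv_plus (f g : C -> C) (z f1 g1 : C) :
  has_cderiv f z f1 -> has_cderiv g z g1 ->
  has_cderiv (fun y => f y + g y)%C z (f1 + g1)%C.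
Proof.
  intros Hf Hg. apply is_derive_has_cderiv.
  exact (is_derive_plus (K := C_AbsRing) (V := AbsRing_NormedModule C_AbsRing) _ _ _ _ _
    (has_cderiv_is_derive_K _ _ _ Hf) (has_cderiv_is_derive_K _ _ _ Hg)).
Qed.

Lemma line_sqr_derive (f : C -> C) (z d f' : C) (t : R) :
  has_cderiv f (z + t * d)%C f' ->
  is_derive (fun s : R => Cmod (f (z + s * d)%C) ^ 2) t
    (2 * Re (d * f' * Cconj (f (z + t * d)))%C).
Proof.
  intros H. assert (K := line_derive_prod f f z d f' f' t H H).
  eapply is_derive_ext; [intros s; symmetry; apply Cmod_sqr|].
  replace (2 * Re (d * f' * Cconj (f (z + t * d)))%C)
    with (Re (d * f' * Cconj (f (z + t * d)) + f (z + t * d) * Cconj (d * f'))%C);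
    [exact K|].
  rewrite re_plus, !(re_mult _ (Cconj _)), !re_conj, !im_conj. ring.
Qed.

(** The term in [d * d] changes sign between [d = 1] and [d = Ci], so adding the two directions
    leaves only squares: this is the Laplacian of [|f|^2]. *)
Lemma line_sqr_derive2 (f f1 : C -> C) (z d f2 : C) :
  has_cderiv f z (f1 z) -> has_cderiv f1 z f2 ->
  is_derive (fun s : R => 2 * Re (d * f1 (z + s * d) * Cconj (f (z + s * d)))%C) 0
    (2 * (Re (d * d * f2 * Cconj (f z))%C + Cmod (d * f1 z)%C ^ 2)).
Proof.
  intros H H1.
  assert (E : (z + 0 * d)%C = z) by ring.
  assert (K := line_derive_prod (fun y => d * f1 y)%C f z d (d * f2)%C (f1 z) 0).
  cbv beta in K. rewrite !E in K. specialize (K (has_cderiv_scal d _ _ _ H1) H).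
  apply is_derive_scal.
  replace (Re (d * d * f2 * Cconj (f z))%C + Cmod (d * f1 z)%C ^ 2)
    with (Re (d * (d * f2) * Cconj (f z) + d * f1 z * Cconj (d * f1 z))%C); [exact K|].
  rewrite Cmod_sqr, re_plus. f_equal. f_equal. ring.
Qed.

Lemma is_derive_Rplus (f g : R -> R) (x a b : R) :
  is_derive f x a -> is_derive g x b -> is_derive (fun y => f y + g y) x (a + b).
Proof. exact (is_derive_plus (K := R_AbsRing) (V := R_NormedModule) f g x a b). Qed.

(* At an interior maximum of [|phi|^2 + eps |z|^2] the Laplacian, which equals
   [4 |phi'|^2 + 4 eps > 0], would have to be nonpositive. *)
Lemma max_modulus (phi phi1 phi2 : C -> C) (r M : R) :
  0 <= r < 1 -> 0 <= M ->
  (forall z, unit_disk z -> has_cderiv phi z (phi1 z)) ->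
  (forall z, unit_disk z -> has_cderiv phi1 z (phi2 z)) ->
  (forall z, Cmod z = r -> Cmod (phi z) <= M) ->
  forall z, Cmod z <= r -> Cmod (phi z) <= M.
Proof.
  intros Hr HM H1 H2 Hbd z0 Hz0.
  apply Rnot_lt_le. intros Hlt.
  set (gap := Cmod (phi z0) ^ 2 - M ^ 2).
  assert (Hgap : 0 < gap) by (unfold gap; nra).
  (* As [r < 1], the added term is at most [eps < gap] on the circle, so [F] stays below [F z0]
     there and its maximum is interior. *)
  set (eps := gap / 2). assert (Heps : 0 < eps) by (unfold eps; lra).
  set (F := fun z => Cmod (phi z) ^ 2 + eps * Cmod z ^ 2).
  destruct (disk_max r F) as (z1 & Hz1 & Hmax); [lra| |].
  { intros w Hw e He. assert (Hwd : unit_disk w) by (unfold unit_disk; lra).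
    destruct (Cmod_sqr_continuous phi w _ (H1 w Hwd) (e / 2)) as (d & Hd & K); [lra|].
    destruct (Cmod_sqr_continuous (fun y => y) w _ (has_cderiv_id w) (e / (2 * eps)))
      as (d' & Hd' & K'); [apply Rdiv_lt_0_compat; lra|].
    exists (Rmin d d'). split; [now apply Rmin_glb_lt|]. intros y hy.
    specialize (K y (Rlt_le_trans _ _ _ hy (Rmin_l _ _))).
    specialize (K' y (Rlt_le_trans _ _ _ hy (Rmin_r _ _))).
    cbv beta in K'.
    apply Rabs_lt_between in K. apply Rabs_lt_between in K'.
    assert (Q : eps * (e / (2 * eps)) = e / 2) by (field; lra).
    unfold F. apply Rabs_def1; nra. }
  assert (Hin : Cmod z1 < r).
  { destruct Hz1 as [h|h]; [assumption|exfalso].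
    assert (B := Hbd z1 h). assert (K := Hmax z0 Hz0). unfold F in K.
    rewrite h in K.
    assert (Cmod (phi z1) ^ 2 <= M ^ 2) by (apply pow_incr; split; [apply Cmod_ge_0|assumption]).
    assert (0 <= Cmod z0 ^ 2) by apply pow2_ge_0.
    assert (r ^ 2 <= 1) by nra. unfold eps, gap in *. nra. }
  assert (Hz1d : unit_disk z1) by (unfold unit_disk; lra).
  assert (Hnear : forall d, Cmod d = 1 -> forall t, Rabs t < r - Cmod z1 ->
    Cmod (z1 + t * d)%C < r).
  { intros d Hd t Ht. eapply Rle_lt_trans; [apply Cmod_triangle|].
    rewrite Cmod_mult, Cmod_R, Hd. lra. }
  assert (Hdir : forall (d : C) (t : R), Cmod d = 1 -> Rabs t < r - Cmod z1 ->
    is_derive (fun s : R => F (z1 + s * d)%C) t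
      (2 * Re (d * phi1 (z1 + t * d) * Cconj (phi (z1 + t * d)))%C
       + eps * (2 * Re (d * 1 * Cconj (z1 + t * d))%C))).
  { intros d t Hd Ht. unfold F.
    apply is_derive_Rplus.
    - apply line_sqr_derive, H1. unfold unit_disk. specialize (Hnear d Hd t Ht). lra.
    - apply is_derive_scal.
      apply (line_sqr_derive (fun y => y)), has_cderiv_id. }
  assert (Hdir2 : forall d : C,
    is_derive (fun t : R => 2 * Re (d * phi1 (z1 + t * d) * Cconj (phi (z1 + t * d)))%C
       + eps * (2 * Re (d * 1 * Cconj (z1 + t * d))%C)) 0
      (2 * (Re (d * d * phi2 z1 * Cconj (phi z1))%C + Cmod (d * phi1 z1)%C ^ 2)
       + eps * (2 * (Re (d * d * 0 * Cconj z1)%C + Cmod (d * 1)%C ^ 2)))).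
  { intros d. apply is_derive_Rplus.
    - apply line_sqr_derive2; auto.
    - apply is_derive_scal.
      apply (line_sqr_derive2 (fun y => y) (fun _ => 1%C));
        [apply has_cderiv_id|apply has_cderiv_const]. }
  (* Restricting [F] to the horizontal and vertical lines through [z1] and adding gives a
     one-variable function whose second derivative at 0 is the Laplacian of [F] at [z1]. *)
  refine (no_strictly_convex_max
    (fun t : R => F (z1 + t * 1)%C + F (z1 + t * Ci)%C) _ _ (r - Cmod z1) _ _
    (is_derive_Rplus _ _ _ _ _ (Hdir2 1%C) (Hdir2 Ci)) _ _).
  - lra.
  - intros t Ht.
    exact (is_derive_Rplus _ _ _ _ _
      (Hdir 1%C t Cmod_1 Ht) (Hdir Ci t Cmod_Ci Ht)).
  -
    rewrite !Cmod_mult, Cmod_1, Cmod_Ci.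
    replace (Ci * Ci * phi2 z1 * Cconj (phi z1))%C
      with (- (1 * 1 * phi2 z1 * Cconj (phi z1)))%C.
    2:{ replace (Ci * Ci)%C with (RtoC (-1)); [|apply injective_projections; simpl; ring].
        apply injective_projections; simpl; ring. }
    rewrite re_opp.
    replace (Ci * Ci * 0 * Cconj z1)%C with (RtoC 0) by ring.
    replace (1 * 1 * 0 * Cconj z1)%C with (RtoC 0) by ring.
    rewrite re_RtoC.
    assert (h := Cmod_ge_0 (phi1 z1)). nra.
  - intros t Ht.
    assert (K1 := Hmax _ (Rlt_le _ _ (Hnear 1%C Cmod_1 t Ht))).
    assert (K2 := Hmax _ (Rlt_le _ _ (Hnear Ci Cmod_Ci t Ht))).
    replace (z1 + 0 * 1)%C with z1 by ring.
    replace (z1 + 0 * Ci)%C with z1 by ring. lra.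
Qed.

(** * Schwarz's lemma and Schur's algorithm *)

(** On the circle of radius [r] the hypothesis bounds [|M / B|] by [1 / r]; the maximum principle
    carries this inside, and [r] may be taken close to 1. *)
Lemma schwarz_division (m b : nat -> C) (M B : C -> C) :
  disk_sum m M -> disk_sum b B ->
  (forall z, unit_disk z -> B z <> 0%C) ->
  (forall z, unit_disk z -> Cmod (z * M z)%C <= Cmod (B z)) ->
  forall z, unit_disk z -> Cmod (M z) <= Cmod (B z).
Proof.
  intros HM HB HB0 Hle.
  destruct (disk_sum_derive m M HM) as (M1 & HM1 & DM).
  destruct (disk_sum_derive _ M1 HM1) as (M2 & _ & DM1).
  destruct (disk_sum_derive b B HB) as (B1 & HB1 & DB).
  destruct (disk_sum_derive _ B1 HB1) as (B2 & _ & DB1).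
  set (phi := fun z => (M z / B z)%C).
  set (phi1 := fun z => ((M1 z * B z - M z * B1 z) / (B z * B z))%C).
  assert (D1 : forall z, unit_disk z -> has_cderiv phi z (phi1 z)).
  { intros z Hz. apply has_cderiv_div; auto. }
  assert (D2 : exists phi2, forall z, unit_disk z -> has_cderiv phi1 z (phi2 z)).
  { eexists. intros z Hz.
    refine (has_cderiv_div (fun z => M1 z * B z - M z * B1 z)%C (fun z => B z * B z)%C z
      (M2 z * B z + M1 z * B1 z + (-1) * (M1 z * B1 z + M z * B2 z))%C _ _ _ _).
    - apply (has_cderiv_ext (fun z => M1 z * B z + (-1) * (M z * B1 z))%C _ _ _ 1 Rlt_0_1).
      { intros y _. ring. }
      apply has_cderiv_plus; [|apply has_cderiv_scal]; apply has_cderiv_mult; auto.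
    - apply (has_cderiv_mult B B); apply DB; assumption.
    - apply Cmult_neq_0; auto. }
  destruct D2 as [phi2 D2].
  intros z Hz. assert (Hz' := Hz). unfold unit_disk in Hz'.
  assert (Hb : 0 < Cmod (B z)) by (apply Cmod_gt_0; auto).
  assert (K : Cmod (phi z) <= 1).
  { apply Rnot_lt_le. intros Hlt.
    set (k := Cmod (phi z)) in *.
    assert (Hk : / k < 1) by (rewrite <- Rinv_1; apply Rinv_lt_contravar; lra).
    assert (Hk0 : 0 < / k) by (apply Rinv_0_lt_compat; lra).
    (* With [k > 1] the midpoint of [1 / k] and 1 exceeds [1 / k], which refutes [k <= 1 / r]; the
       maximum keeps [z] in the disk of radius [r]. *)
    set (r := Rmax (Cmod z) ((1 + / k) / 2)).
    assert (Hr1 : r < 1) by (apply Rmax_lub_lt; lra).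
    assert (Hr2 : Cmod z <= r) by apply Rmax_l.
    assert (Hr3 : (1 + / k) / 2 <= r) by apply Rmax_r.
    clearbody r.
    assert (Hmm : k <= / r).
    { apply (max_modulus phi phi1 phi2 r (/ r)); auto; [lra| |].
      - left. apply Rinv_0_lt_compat. lra.
      - intros w Hw. assert (Hwd : unit_disk w) by (unfold unit_disk; lra).
        unfold phi. rewrite Cmod_div by auto.
        specialize (Hle w Hwd). rewrite Cmod_mult, Hw in Hle.
        assert (Hbw : 0 < Cmod (B w)) by (apply Cmod_gt_0; auto).
        apply Rmult_le_reg_r with (Cmod (B w)); [assumption|].
        unfold Rdiv. rewrite Rmult_assoc, Rinv_l by lra.
        apply Rmult_le_reg_l with r; [lra|].
        rewrite <- (Rmult_assoc r (/ r)), Rinv_r by lra. lra. }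
    assert (k * r <= 1).
    { apply Rmult_le_compat_r with (r := r) in Hmm; [|lra]. rewrite Rinv_l in Hmm; lra. }
    assert (k * / k = 1) by (apply Rinv_r; lra). nra. }
  unfold phi in K. rewrite Cmod_div in K by auto.
  apply Rmult_le_compat_r with (r := Cmod (B z)) in K; [|lra].
  unfold Rdiv in K. rewrite Rmult_assoc, Rinv_l in K by lra. lra.
Qed.

(* [a / b] is the Taylor series of an analytic map from the unit disk to its closure. *)
Definition schur_pair (a b : nat -> C) : Prop :=
  exists A B : C -> C, disk_sum a A /\ disk_sum b B /\
    forall z, unit_disk z -> B z <> 0%C /\ Cmod (A z) <= Cmod (B z).

Lemma unit_disk_0 : unit_disk 0%C.
Proof. unfold unit_disk. rewrite Cmod_0. lra. Qed.

Lemma disk_sum_at_0 (a : nat -> C) (A : C -> C) : disk_sum a A -> A 0%C = a 0%nat.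
Proof.
  intros H. exact (power_sum_unique _ _ _ _ (H _ unit_disk_0) (power_sum_0 a)).
Qed.

Lemma schur_pair_head (a b : nat -> C) :
  schur_pair a b -> b 0%nat <> 0%C /\ Cmod (a 0%nat) <= Cmod (b 0%nat).
Proof.
  intros (A & B & HA & HB & H).
  rewrite <- (disk_sum_at_0 a A HA), <- (disk_sum_at_0 b B HB).
  apply H, unit_disk_0.
Qed.

Lemma schur_pair_scal (c : C) (a b : nat -> C) :
  Cmod c <= 1 -> schur_pair a b -> schur_pair (fun n => c * a n)%C b.
Proof.
  intros Hc (A & B & HA & HB & H).
  exists (fun z => c * A z)%C, B. split; [|split; [assumption|]].
  - intros z Hz. now apply power_sum_scal, HA.
  - intros z Hz. destruct (H z Hz) as [H0 H1]. split; [assumption|].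
    rewrite Cmod_mult. assert (h := Cmod_ge_0 (A z)). nra.
Qed.

(** The homogeneous form of the fact that, for [|g| < 1], the map
    [w |-> (w - g) / (1 - Cconj g * w)] preserves the disk, with [w = x / y]. *)
Lemma Cmod_schur_identity (x y g : C) :
  Cmod (y - Cconj g * x)%C ^ 2 - Cmod (x - g * y)%C ^ 2
  = (1 - Cmod g ^ 2) * (Cmod y ^ 2 - Cmod x ^ 2).
Proof.
  rewrite !Cmod2_alt. destruct x, y, g. simpl. ring.
Qed.

Lemma Cmod_le_of_sqr (x y : C) : Cmod x ^ 2 <= Cmod y ^ 2 -> Cmod x <= Cmod y.
Proof.
  intros H. assert (hx := Cmod_ge_0 x). assert (hy := Cmod_ge_0 y). nra.
Qed.

(** Removes the singularity of [A z / z] at 0: away from 0 the shifted series sums to the quotient,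
    and at 0 it converges trivially. *)
Lemma disk_sum_tail (a : nat -> C) (A : C -> C) :
  disk_sum a A -> a 0%nat = 0%C ->
  exists A', disk_sum (fun n => a (S n)) A' /\
    forall z, unit_disk z -> (z * A' z)%C = A z.
Proof.
  intros H H0.
  assert (L : forall z, unit_disk z -> z <> 0%C ->
    power_sum (fun n => a (S n)) z (A z / z)%C).
  { intros z Hz Hz0. replace (A z) with (A z - a 0%nat)%C by (rewrite H0; ring).
    apply power_sum_shift; auto. }
  destruct (disk_sum_exists (fun n => a (S n))) as [A' HA'].
  { intros z Hz. destruct (Ceq_dec z 0%C) as [->|Hz0].
    - eexists. apply power_sum_0.
    - eexists. apply L; assumption. }
  exists A'. split; [assumption|].
  intros z Hz. destruct (Ceq_dec z 0%C) as [->|Hz0].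
  - rewrite (disk_sum_at_0 a A H), H0. ring.
  - rewrite (power_sum_unique _ _ _ _ (HA' z Hz) (L z Hz Hz0)). field. assumption.
Qed.

(** For [w = a / b] and [g = w(0)] the new quotient is [(w - g) / (z (1 - Cconj g * w))].
    [Cmod_schur_identity] bounds it before the division by [z], and [schwarz_division] after it. *)
Lemma schur_step (a b : nat -> C) (g : C) :
  schur_pair a b -> a 0%nat = (g * b 0%nat)%C -> Cmod g < 1 ->
  schur_pair (fun n => a (S n) - g * b (S n))%C (fun n => b n - Cconj g * a n)%C.
Proof.
  intros (A & B & HA & HB & H) H0 Hg.
  assert (Hlin : forall (c : C) (a b : nat -> C) (A B : C -> C),
    disk_sum a A -> disk_sum b B ->
    disk_sum (fun n => a n - c * b n)%C (fun z => A z - c * B z)%C).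
  { intros c a' b' A' B' HA' HB' z Hz.
    replace (A' z - c * B' z)%C with (A' z + (- c) * B' z)%C by ring.
    eapply power_sum_ext;
      [|exact (power_sum_plus _ _ _ _ _ (HA' z Hz) (power_sum_scal (- c)%C _ _ _ (HB' z Hz)))].
    intros n. cbv beta. ring. }
  assert (HN := Hlin g _ _ _ _ HA HB).
  assert (HD := Hlin (Cconj g) _ _ _ _ HB HA).
  destruct (disk_sum_tail _ _ HN) as (A' & HA' & HA'e).
  { cbv beta. rewrite H0. ring. }
  cbv beta in HA', HA'e.
  exists A', (fun z => B z - Cconj g * A z)%C.
  split; [assumption|]. split; [assumption|].
  (* A zero would give [|B z| = |g| |A z| <= |g| |B z| < |B z|]. *)
  assert (Hn0 : forall z, unit_disk z -> (B z - Cconj g * A z)%C <> 0%C).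
  { intros z Hz Heq. destruct (H z Hz) as [hb hle].
    assert (E : B z = (Cconj g * A z)%C).
    { replace (B z) with ((B z - Cconj g * A z) + Cconj g * A z)%C by ring.
      rewrite Heq. ring. }
    assert (hm : 0 < Cmod (B z)) by now apply Cmod_gt_0.
    apply (f_equal Cmod) in E. rewrite Cmod_mult, Cmod_conj in E.
    assert (h1 := Cmod_ge_0 g). assert (h2 := Cmod_ge_0 (A z)). nra. }
  intros z Hz. split; [auto|]. revert z Hz.
  apply (schwarz_division _ _ _ _ HA' HD Hn0).
  intros z Hz. rewrite HA'e by assumption. destruct (H z Hz) as [_ hle].
  apply Cmod_le_of_sqr.
  assert (I := Cmod_schur_identity (A z) (B z) g).
  assert (h1 := Cmod_ge_0 g). assert (h2 := Cmod_ge_0 (A z)).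
  assert (0 <= (1 - Cmod g ^ 2) * (Cmod (B z) ^ 2 - Cmod (A z) ^ 2)); [|lra].
  apply Rmult_le_pos; nra.
Qed.

(** * Coefficient inequalities for bounded functions *)

Lemma le_at_1_of_left (h : R -> R) (c : R) :
  continuity_pt h 1 -> (forall x, 0 < x < 1 -> h x <= c) -> h 1 <= c.
Proof.
  intros Hc H. apply Rnot_lt_le. intros Hlt.
  destruct (Hc (h 1 - c)) as (d & Hd & K); [lra|].
  set (x := 1 - Rmin d 1 / 2).
  assert (h1 := Rmin_l d 1). assert (h2 := Rmin_r d 1).
  assert (h3 : 0 < Rmin d 1) by (apply Rmin_glb_lt; lra).
  assert (Hx : 0 < x < 1) by (unfold x; lra).
  specialize (K x). simpl in K. unfold R_dist, D_x, no_cond in K.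
  specialize (H x Hx).
  assert (Q : Rabs (h x - h 1) < h 1 - c).
  { apply K. split; [split; [exact I|lra]|]. rewrite Rabs_left1; unfold x; lra. }
  apply Rabs_lt_between in Q. lra.
Qed.

(* If [|a 0| = |b 0|], no Schur step is available, so [a] is first scaled by
   [rho < 1], and then [rho] tends to 1. *)
Lemma schur_first_order (a b : nat -> C) :
  schur_pair a b ->
  Cmod (a 1%nat * b 0%nat - a 0%nat * b 1%nat)%C
    <= Cmod (b 0%nat) ^ 2 - Cmod (a 0%nat) ^ 2.
Proof.
  intros H. destruct (schur_pair_head a b H) as [Hb0 Hle].
  assert (Hb : 0 < Cmod (b 0%nat)) by now apply Cmod_gt_0.
  assert (Ha := Cmod_ge_0 (a 0%nat)).
  set (X := Cmod (a 1%nat * b 0%nat - a 0%nat * b 1%nat)%C).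
  enough (K : forall rho, 0 < rho < 1 ->
    rho * X + rho ^ 2 * Cmod (a 0%nat) ^ 2 <= Cmod (b 0%nat) ^ 2).
  { assert (L := le_at_1_of_left (fun rho => rho * X + rho ^ 2 * Cmod (a 0%nat) ^ 2) _
      ltac:(reg) K). cbv beta in L. lra. }
  intros rho Hrho.
  assert (Hr : Cmod rho = rho) by (rewrite Cmod_R, Rabs_pos_eq; lra).
  assert (Hs := schur_pair_scal rho a b ltac:(lra) H).
  set (g := (rho * a 0%nat / b 0%nat)%C).
  assert (Eg : (rho * a 0%nat)%C = (g * b 0%nat)%C) by (unfold g; field; assumption).
  assert (Hgm : Cmod g * Cmod (b 0%nat) = rho * Cmod (a 0%nat)).
  { rewrite <- Cmod_mult, <- Eg, Cmod_mult, Hr. reflexivity. }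
  assert (Hg0 := Cmod_ge_0 g).
  assert (Hg : Cmod g < 1) by nra.
  assert (S := schur_step _ _ g Hs Eg Hg).
  apply schur_pair_head in S. destruct S as [_ S].
  (* The factor [|b 0|] clears the quotient [g]: the right-hand side becomes [(1 - |g|^2) |b 0|^2 =
     |b 0|^2 - rho^2 |a 0|^2]. *)
  apply Rmult_le_compat_r with (r := Cmod (b 0%nat)) in S; [|lra].
  rewrite <- !Cmod_mult in S.
  replace ((rho * a 1%nat - g * b 1%nat) * b 0%nat)%C
    with (rho * (a 1%nat * b 0%nat - a 0%nat * b 1%nat))%C in S.
  2:{ replace ((rho * a 1%nat - g * b 1%nat) * b 0%nat)%C
        with (rho * a 1%nat * b 0%nat - g * b 0%nat * b 1%nat)%C by ring.
      rewrite <- Eg. ring. }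
  rewrite Cmod_mult, Hr in S. fold X in S.
  rewrite Eg, Cmod_mult in S.
  replace (b 0%nat - Cconj g * (g * b 0%nat))%C
    with (RtoC (1 - Cmod g ^ 2) * b 0%nat)%C in S.
  2:{ rewrite RtoC_minus, Cmod2_conj. ring. }
  rewrite Cmod_mult, Cmod_R, Rabs_pos_eq in S by nra.
  assert (E : (rho * Cmod (a 0%nat)) ^ 2 = (Cmod g * Cmod (b 0%nat)) ^ 2) by now rewrite Hgm.
  nra.
Qed.

Lemma schur_hankel_strict (c w2 w3 : C) :
  Cmod c < 1 ->
  Cmod w2 <= 1 - Cmod c ^ 2 ->
  Cmod ((1 - Cmod c ^ 2)%R * w3 + Cconj c * w2 ^ 2)%C
    <= (1 - Cmod c ^ 2) ^ 2 - Cmod w2 ^ 2 ->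
  Cmod (3 * c * w3 + 3 * c ^ 2 * w2 - 2 * w2 ^ 2)%C <= 9 / 4.
Proof.
  intros Hc H2 H3.
  set (k := Cmod c) in *. set (t := 1 - k ^ 2) in *. set (r := Cmod w2) in *.
  assert (Hk : 0 <= k) by apply Cmod_ge_0.
  assert (Hr : 0 <= r) by apply Cmod_ge_0.
  assert (Ht : 0 < t) by (unfold t; nra).
  set (E := (3 * c * w3 + 3 * c ^ 2 * w2 - 2 * w2 ^ 2)%C).
  (* Multiplication by [t] produces the combination bounded in [H3]; the correction it costs has
     coefficient [3 c Cconj c = 3 k^2]. *)
  assert (HE : (t * E)%C = (3 * c * (t * w3 + Cconj c * w2 ^ 2)
    + (- (3 * RtoC (k ^ 2) * w2 ^ 2) + (3 * t * c ^ 2 * w2 + - (2 * t * w2 ^ 2))))%C).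
  { unfold E. unfold k. rewrite Cmod2_conj. ring. }
  assert (B : t * Cmod E <=
    3 * k * (t ^ 2 - r ^ 2) + (3 * k ^ 2 * r ^ 2 + (3 * t * k ^ 2 * r + 2 * t * r ^ 2))).
  { replace (t * Cmod E) with (Cmod (t * E)%C)
      by (rewrite Cmod_mult, Cmod_R, Rabs_pos_eq; lra).
    rewrite HE.
    eapply Rle_trans; [apply Cmod_triangle|]. apply Rplus_le_compat.
    { rewrite !Cmod_mult, Cmod_R, Rabs_pos_eq by lra. fold k.
      apply Rmult_le_compat_l; [lra|assumption]. }
    eapply Rle_trans; [apply Cmod_triangle|]. apply Rplus_le_compat.
    { rewrite Cmod_opp, !Cmod_mult, !Cmod_pow, !Cmod_R, !Rabs_pos_eq by (try apply pow2_ge_0; lra).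
      fold r. lra. }
    eapply Rle_trans; [apply Cmod_triangle|]. apply Rplus_le_compat.
    { rewrite !Cmod_mult, !Cmod_pow, !Cmod_R, !Rabs_pos_eq by lra. fold r k. lra. }
    rewrite Cmod_opp, !Cmod_mult, !Cmod_pow, !Cmod_R, !Rabs_pos_eq by lra. fold r. lra. }
  (* The right-hand side increases with [r]; at [r = t] it is
     [t^2 (2 + 4 k^2)], and [t (2 + 4 k^2) = 9/4 - (2 k^2 - 1/2)^2]. *)
  assert (B2 : t * Cmod E <= t ^ 2 * (2 + 4 * k ^ 2)).
  { eapply Rle_trans; [exact B|].
    (* [2 + k^2 - 3 k] is the total coefficient of [r^2] in the bound. *)
    assert (P : 0 <= (2 + k ^ 2 - 3 * k) * (t ^ 2 - r ^ 2)).
    { apply Rmult_le_pos; [|nra].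
      replace (2 + k ^ 2 - 3 * k) with ((1 - k) * (2 - k)) by ring.
      apply Rmult_le_pos; lra. }
    assert (Q : 0 <= 3 * t * k ^ 2 * (t - r)).
    { apply Rmult_le_pos; [|lra].
      apply Rmult_le_pos; [lra|apply pow2_ge_0]. }
    assert (T : 3 * k ^ 2 + 2 * t = 2 + k ^ 2) by (unfold t; ring).
    replace (3 * k * (t ^ 2 - r ^ 2) + (3 * k ^ 2 * r ^ 2 + (3 * t * k ^ 2 * r + 2 * t * r ^ 2)))
      with (3 * k * (t ^ 2 - r ^ 2) + (3 * k ^ 2 + 2 * t) * r ^ 2 + 3 * t * k ^ 2 * r) by ring.
    rewrite T. nra. }
  apply Rmult_le_reg_l with t; [assumption|].
  eapply Rle_trans; [exact B2|].
  replace (t ^ 2 * (2 + 4 * k ^ 2)) with (t * (9 / 4 - (2 * k ^ 2 - 1 / 2) ^ 2))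
    by (unfold t; field).
  apply Rmult_le_compat_l; [lra|]. assert (h := pow2_ge_0 (2 * k ^ 2 - 1 / 2)). lra.
Qed.

(** Long division by [b], with [b 0 = 1], shows that [a 0], [w2], [w3] are the first Taylor
    coefficients of [a / b]. After one Schur step, [schur_pair_head] and [schur_first_order] supply
    the two hypotheses of [schur_hankel_strict]. *)
Lemma schur_hankel (a b : nat -> C) :
  schur_pair a b -> b 0%nat = 1%C ->
  let w2 := (a 1%nat - a 0%nat * b 1%nat)%C in
  let w3 := (a 2%nat - a 0%nat * b 2%nat - w2 * b 1%nat)%C in
  Cmod (3 * a 0%nat * w3 + 3 * a 0%nat ^ 2 * w2 - 2 * w2 ^ 2)%C <= 9 / 4.
Proof.
  intros H Hb w2 w3.
  replace (3 * a 0%nat * w3 + 3 * a 0%nat ^ 2 * w2 - 2 * w2 ^ 2)%C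
    with (3 * a 0%nat * w3 - 2 * w2 ^ 2 + 3 * a 0%nat ^ 2 * w2)%C by ring.
  set (X := (3 * a 0%nat * w3 - 2 * w2 ^ 2)%C).
  set (Y := (3 * a 0%nat ^ 2 * w2)%C).
  (* Scaling [a] by [rho] makes [|c| < 1]. It multiplies the quadratic part [X] by [rho^2] and the
     cubic part [Y] by [rho^3 = rho^2 - rho^2 (1 - rho)]; the last term fades as [rho] tends to
     1. *)
  enough (K : forall rho, 0 < rho < 1 ->
    rho ^ 2 * Cmod (X + Y)%C - rho ^ 2 * (1 - rho) * Cmod Y <= 9 / 4).
  { assert (L := le_at_1_of_left (fun rho =>
      rho ^ 2 * Cmod (X + Y)%C - rho ^ 2 * (1 - rho) * Cmod Y) _ ltac:(reg) K).
    cbv beta in L. lra. }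
  intros rho Hrho.
  assert (Hr : Cmod rho = rho) by (rewrite Cmod_R, Rabs_pos_eq; lra).
  assert (Hs := schur_pair_scal rho a b ltac:(lra) H).
  destruct (schur_pair_head a b H) as [_ Hle]. rewrite Hb, Cmod_1 in Hle.
  set (c := (rho * a 0%nat)%C).
  assert (Hc : Cmod c < 1).
  { unfold c. rewrite Cmod_mult, Hr. assert (h := Cmod_ge_0 (a 0%nat)). nra. }
  assert (St := schur_step _ _ c Hs ltac:(cbv beta; rewrite Hb; unfold c; ring) Hc).
  assert (V1 := proj2 (schur_pair_head _ _ St)).
  assert (V2 := schur_first_order _ _ St).
  cbv beta in V1, V2.
  assert (E0 : (b 0%nat - Cconj c * (rho * a 0%nat))%C = RtoC (1 - Cmod c ^ 2)).
  { rewrite RtoC_minus, Cmod2_conj, Hb. unfold c. ring. }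
  assert (E1 : (rho * a 1%nat - c * b 1%nat)%C = (rho * w2)%C) by (unfold w2, c; ring).
  assert (Ht : 0 <= 1 - Cmod c ^ 2) by (assert (h := Cmod_ge_0 c); nra).
  rewrite E0, E1, Cmod_R, Rabs_pos_eq in V1, V2 by assumption.
  assert (F := schur_hankel_strict c (rho * w2)%C (rho * w3)%C Hc V1).
  assert (HF : Cmod (3 * c * (rho * w3) + 3 * c ^ 2 * (rho * w2) - 2 * (rho * w2) ^ 2)%C <= 9 / 4).
  { apply F.
    replace ((1 - Cmod c ^ 2)%R * (rho * w3) + Cconj c * (rho * w2) ^ 2)%C
      with ((rho * a 2%nat - c * b 2%nat) * (1 - Cmod c ^ 2)%R
        - rho * w2 * (b 1%nat - Cconj c * (rho * a 1%nat)))%C; [exact V2|].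
    rewrite RtoC_minus, Cmod2_conj.
    unfold w3. replace (a 1%nat) with (w2 + a 0%nat * b 1%nat)%C by (unfold w2; ring).
    unfold c. ring. }
  replace (3 * c * (rho * w3) + 3 * c ^ 2 * (rho * w2) - 2 * (rho * w2) ^ 2)%C
    with (RtoC rho ^ 2 * (X + Y) - RtoC rho ^ 2 * RtoC (1 - rho) * Y)%C in HF
    by (unfold X, Y, c; rewrite RtoC_minus; ring).
  assert (T := Cmod_triangle_rev (RtoC rho ^ 2 * (X + Y))%C (RtoC rho ^ 2 * RtoC (1 - rho) * Y)%C).
  rewrite !Cmod_mult, !Cmod_pow, !Cmod_R, !Rabs_pos_eq in T by lra. lra.
Qed.

(** * From convexity to a Schur pair *)

Lemma convexity_cleared (u v : C) :
  v <> 0%C ->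
  Cmod v ^ 2 * Re (1 + u / v)%C = Re ((v + u) * Cconj v)%C.
Proof.
  intros Hv. rewrite <- re_scal_l, Cmod2_conj. f_equal. field. assumption.
Qed.

(* Convexity makes [t |-> |t f'(t z)|^2] nondecreasing along each radius. *)
Lemma convex_derive_neq_0 (f1 f2 : C -> C) :
  f1 0%C <> 0%C ->
  (forall z, unit_disk z -> has_cderiv f1 z (f2 z)) ->
  (forall z, unit_disk z -> 0 <= Re (1 + z * f2 z / f1 z)%C) ->
  forall z, unit_disk z -> f1 z <> 0%C.
Proof.
  intros H0 Hd Hc z Hz Hz1.
  assert (Hseg : forall t : R, 0 <= t <= 1 -> unit_disk (0 + t * z)%C).
  { intros t Ht. unfold unit_disk in *. rewrite Cplus_0_l, Cmod_mult, Cmod_R, Rabs_pos_eq by lra.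
    assert (h := Cmod_ge_0 z). nra. }
  set (u := fun y => (y * f1 y)%C).
  set (Q := fun t : R => Cmod (u (0 + t * z)%C) ^ 2).
  set (Q1 := fun t : R => 2 * Re (z * (1 * f1 (0 + t * z) + (0 + t * z) * f2 (0 + t * z))
     * Cconj (u (0 + t * z)))%C).
  assert (HQ : forall t, 0 <= t <= 1 -> is_derive Q t (Q1 t)).
  { intros t Ht. apply line_sqr_derive.
    apply (has_cderiv_mult (fun y => y) f1); [apply has_cderiv_id|auto]. }
  assert (HQ1 : forall t, 0 <= t <= 1 -> 0 <= Q1 t).
  { intros t Ht. unfold Q1, u. set (y := (0 + t * z)%C).
    replace (z * (1 * f1 y + y * f2 y) * Cconj (y * f1 y))%C
      with (RtoC (t * Cmod z ^ 2) * ((f1 y + y * f2 y) * Cconj (f1 y)))%C.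
    2:{ rewrite RtoC_mult, Cmod2_conj, Cmult_conj.
        replace (Cconj y) with (t * Cconj z)%C; [ring|].
        unfold y. rewrite Cplus_0_l, Cmult_conj. f_equal.
        apply injective_projections; simpl; ring. }
    rewrite re_scal_l.
    assert (0 <= Re ((f1 y + y * f2 y) * Cconj (f1 y))%C).
    { destruct (Ceq_dec (f1 y) 0%C) as [E|E].
      - rewrite E. right. simpl. ring.
      - rewrite <- convexity_cleared by assumption.
        apply Rmult_le_pos; [apply pow2_ge_0|]. apply Hc, Hseg, Ht. }
    assert (0 <= t * Cmod z ^ 2) by (apply Rmult_le_pos; [lra|apply pow2_ge_0]).
    assert (0 <= t * Cmod z ^ 2 * Re ((f1 y + y * f2 y) * Cconj (f1 y))%C)
      by now apply Rmult_le_pos.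
    lra. }
  assert (HQ0 : Q 1 = 0).
  { unfold Q, u. replace (0 + 1 * z)%C with z by ring. rewrite Hz1, Cmult_0_r, Cmod_0. ring. }
  (* [Q] is nonnegative, nondecreasing and zero at 1, hence zero throughout; then [f1] vanishes
     arbitrarily near 0, against continuity and [f1 0 <> 0]. *)
  assert (Hv : forall t, 0 < t < 1 -> f1 (0 + t * z)%C = 0%C).
  { intros t Ht.
    destruct (MVT_cor2 Q Q1 t 1) as (c & Hc1 & Hc2); [lra| |].
    { intros c Hct. apply is_derive_Reals, HQ. lra. }
    assert (Hp := HQ1 c ltac:(lra)).
    assert (Hle : Q t <= 0) by nra.
    assert (E : Cmod (u (0 + t * z)%C) = 0).
    { unfold Q in Hle. assert (h := Cmod_ge_0 (u (0 + t * z)%C)). nra. }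
    apply Cmod_eq_0 in E. unfold u in E.
    destruct (Ceq_dec (f1 (0 + t * z)%C) 0%C) as [|Hn]; [assumption|exfalso].
    apply (Cmult_neq_0 (0 + t * z)%C _) in Hn; [now apply Hn|].
    rewrite Cplus_0_l. apply Cmult_neq_0.
    - intros h. apply RtoC_inj in h. lra.
    - intros ->. now apply H0. }
  destruct (has_cderiv_continuous f1 0%C _ (Hd _ unit_disk_0) (Cmod (f1 0%C)))
    as (d & Hdp & K); [now apply Cmod_gt_0|].
  set (t := Rmin d 1 / 2).
  assert (h1 := Rmin_l d 1). assert (h2 := Rmin_r d 1).
  assert (h3 : 0 < Rmin d 1) by (apply Rmin_glb_lt; lra).
  assert (Ht : 0 < t < 1) by (unfold t; lra).
  specialize (K (0 + t * z)%C). rewrite (Hv t Ht) in K.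
  replace (0 - f1 0)%C with (- f1 0)%C in K by ring. rewrite Cmod_opp in K.
  apply (Rlt_irrefl (Cmod (f1 0%C))), K.
  replace (0 + t * z - 0)%C with (t * z)%C by ring.
  rewrite Cmod_mult, Cmod_R, Rabs_pos_eq by lra.
  unfold unit_disk in Hz. assert (h := Cmod_ge_0 z). unfold t in *. nra.
Qed.

(* [f'' / (2 f' + z f'')] is [(p - 1) / (z (p + 1))] for [p = 1 + z f'' / f']. *)
Lemma convex_schur_pair (a : nat -> C) (f : C -> C) :
  class_CV f -> normalized_expansion f a ->
  exists b, schur_pair (fun n => / 2 * cdiff (cdiff a) n)%C b /\
    b 0%nat = 1%C /\ b 1%nat = (3 * a 2%nat)%C /\ b 2%nat = (6 * a 3%nat)%C.
Proof.
  intros [_ Hcv] (_ & Ha1 & Hser).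
  assert (Hf : disk_sum a f) by (intros z Hz; apply power_sum_pseries; auto).
  destruct (disk_sum_derive a f Hf) as (f1 & Hf1 & D1).
  destruct (disk_sum_derive _ f1 Hf1) as (f2 & Hf2 & D2).
  assert (Hc : forall z, unit_disk z -> 0 < Re (1 + z * f2 z / f1 z)%C).
  { intros z Hz. specialize (Hcv z Hz).
    rewrite (has_cderiv_C_derive f z (f1 z) (D1 z Hz)) in Hcv.
    rewrite (has_cderiv_C_derive (C_derive f) z (f2 z)) in Hcv; [assumption|].
    unfold unit_disk in Hz.
    apply (has_cderiv_ext f1 _ _ _ (1 - Cmod z)); [lra| |auto].
    intros y Hy. symmetry. apply has_cderiv_C_derive, D1.
    unfold unit_disk. assert (h := Cmod_triangle_rev y z). lra. }
  assert (H10 : f1 0%C = 1%C).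
  { rewrite (disk_sum_at_0 _ _ Hf1). unfold cdiff. rewrite Ha1. simpl. ring. }
  assert (Hn : forall z, unit_disk z -> f1 z <> 0%C).
  { apply (convex_derive_neq_0 f1 f2); auto.
    - rewrite H10. apply C1_nz.
    - intros z Hz. left. auto. }
  assert (HA : disk_sum (fun n => / 2 * cdiff (cdiff a) n)%C (fun z => / 2 * f2 z)%C).
  { intros z Hz. now apply power_sum_scal, Hf2. }
  (* Numerator and denominator are both halved, so that the denominator [f' + z f'' / 2] has
     constant term 1. *)
  set (q := PS_incr_1 (V := C_NormedModule) (fun n => / 2 * cdiff (cdiff a) n)%C : nat -> C).
  assert (HB : disk_sum (fun n => cdiff a n + q n)%C (fun z => f1 z + z * (/ 2 * f2 z))%C).
  { intros z Hz. apply power_sum_plus; [now apply Hf1|].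
    apply power_sum_incr. now apply HA. }
  (* For [v = f'] and [w = z f'' / 2], the difference [|v + w|^2 - |w|^2] is
     [Re ((v + 2 w) * Cconj v)], which convexity makes positive. Strictness also keeps the
     denominator from vanishing. *)
  assert (Hsq : forall z, unit_disk z ->
    Cmod (z * (/ 2 * f2 z))%C ^ 2 < Cmod (f1 z + z * (/ 2 * f2 z))%C ^ 2).
  { intros z Hz. specialize (Hc z Hz). specialize (Hn z Hz).
    assert (P : 0 < Cmod (f1 z) ^ 2) by (apply pow_lt; now apply Cmod_gt_0).
    assert (E := convexity_cleared (z * f2 z)%C (f1 z) Hn).
    set (v := f1 z) in *. set (w := (z * (/ 2 * f2 z))%C).
    replace (z * f2 z)%C with (2 * w)%C in E by (unfold w; field).
    replace (z * f2 z)%C with (2 * w)%C in Hc by (unfold w; field).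
    assert (R : Cmod (v + w)%C ^ 2 = Cmod w ^ 2 + Re ((v + 2 * w) * Cconj v)%C).
    { rewrite !Cmod2_alt. destruct v, w. simpl. ring. }
    rewrite R, <- E. assert (0 < Cmod v ^ 2 * Re (1 + 2 * w / v)%C) by now apply Rmult_lt_0_compat.
    lra. }
  assert (HB0 : forall z, unit_disk z -> (f1 z + z * (/ 2 * f2 z))%C <> 0%C).
  { intros z Hz E. specialize (Hsq z Hz). rewrite E, Cmod_0 in Hsq.
    assert (h := pow2_ge_0 (Cmod (z * (/ 2 * f2 z))%C)). simpl in *. lra. }
  exists (fun n => cdiff a n + q n)%C. split; [|split; [|split]].
  - exists (fun z => / 2 * f2 z)%C, (fun z => f1 z + z * (/ 2 * f2 z))%C.
    split; [assumption|]. split; [assumption|]. intros z Hz. split; [auto|]. revert z Hz.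
    apply (schwarz_division _ _ _ _ HA HB HB0).
    intros z Hz. apply Cmod_le_of_sqr, Rlt_le, Hsq, Hz.
  - unfold cdiff, q. simpl. rewrite Ha1. change (RtoC 1 * RtoC 1 + RtoC 0 = 1)%C. ring.
  - unfold q, cdiff. simpl. rewrite !RtoC_plus. field.
  - unfold q, cdiff. simpl. rewrite !RtoC_plus. field.
Qed.

Theorem corollary2p1 (f : C -> C) (a : nat -> C)
  (hf : class_CV_Sigma f)
  (ha : normalized_expansion f a) :
  Cmod (a 2%nat * a 4%nat - a 3%nat * a 3%nat)%C <= 1 / 8.
Proof.
  destruct hf as (_ & hcv & _).
  destruct (convex_schur_pair a f hcv ha) as (b & Hp & Hb0 & Hb1 & Hb2).
  assert (H := schur_hankel _ b Hp Hb0). cbv zeta beta in H.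
  rewrite Hb1, Hb2 in H.
  (* The numerator begins [a 2], [3 a 3], [6 a 4] and the denominator [1], [3 a 2], [6 a 3].
     Substitution leaves 18 times the determinant, and [(9/4) / 18 = 1/8]. *)
  match type of H with Cmod ?x <= _ =>
    replace x with (18 * (a 2%nat * a 4%nat - a 3%nat * a 3%nat))%C in H end.
  - rewrite Cmod_mult, Cmod_R, Rabs_pos_eq in H by lra. lra.
  - unfold cdiff. simpl. rewrite !RtoC_plus. field.
Qed.
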